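(* Let $p$ be a prime, $k\ge0$ and $m\ge1$ integers, and let $\mathcal S_1,\dots,\mathcal S_m$ be $\mathbb Z_p$-combinatorial spheres (not necessarily of the same dimension) with pairwise disjoint vertex sets. Let $x$ be a new vertex. Then there does not exist a simplicial map \[f:\ x*\operatorname{Bd}^k(\mathcal S_1*\cdots*\mathcal S_m)\to \mathcal S_1*\cdots*\mathcal S_m\] whose restriction $f|_{\operatorname{Bd}^k(\mathcal S_1*\cdots*\mathcal S_m)}:\operatorname{Bd}^k(\mathcal S_1*\cdots*\mathcal S_m)\to\mathcal S_1*\cdots*\mathcal S_m$ is $\mathbb Z_p$-equivariant.
   Context: A simplicial complex is a finite nonempty collection of finite sets closed under subsets (so it contains $\emptyset$); $\dim\sigma=|\sigma|-1$; $\alpha$ is a facet of $\beta$ if $\alpha\subseteq\beta$ and $\dim\alpha=\dim\beta-1$. A discrete vector field $\mathcal V$ on $\mathcal K$ is a set of pairs $(\alpha,\beta)$ of simplices ($\alpha=\emptyset$ allowed) with $\alpha$ a facet of $\beta$, each simplex in at most one pair. A $\mathcal V$-trajectory is a sequence $\beta_0,\alpha_1,\beta_1,\dots,\alpha_r,\beta_r$ of alternately $q$- and $(q-1)$-simplices with $(\alpha_i,\beta_i)\in\mathcal V$, $\alpha_i\subsetneq\beta_{i-1}$, $\beta_{i-1}\ne\beta_i$; it is nontrivial closed if $r>0$ and $\beta_r=\beta_0$. A gradient vector field has no nontrivial closed trajectory. A nonempty simplex is critical if it lies in no pair, or is a $0$-simplex $\sigma$ with $(\emptyset,\sigma)\in\mathcal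 V$. A $d$-dimensional pseudomanifold is a simplicial complex whose maximal simplices all have dimension $d$, with every $(d-1)$-simplex in exactly two $d$-simplices, and any two $d$-simplices joined by a chain of $d$-simplices in which consecutive ones meet in a $(d-1)$-simplex. A combinatorial $d$-sphere is a $d$-dimensional pseudomanifold admitting a gradient vector field with exactly two critical simplices, one of dimension $d$ and one of dimension $0$. The join of complexes with disjoint vertex sets is $\mathcal K_1*\mathcal K_2=\{\sigma\sqcup\tau:\sigma\in\mathcal K_1,\tau\in\mathcal K_2\}$; the cone $x*\mathcal K$ is $\{\emptyset,\{x\}\}*\mathcal K$ for $x\notin V(\mathcal K)$. $\operatorname{Bd}(\mathcal K)$ has vertices $v_\sigma$ for nonempty $\sigma\in\mathcal K$ and simplices $\{v_{\sigma_0},\dots,v_{\sigma_n}\}$ for chains $\sigma_0\subsetneq\dots\subsetneq\sigma_n$ (and $\emptyset$); $\operatorname{Bd}^k$ is its $k$-fold iterate ($\operatorname{Bd}^0=\mathrm{id}$). A simplicial map is a vertex map sending simplices to simplices. A simplicial $\mathbb Z_p$-action on a complex is an action by simplicial automorphisms; it is free if no non-identity element maps a nonempty simplex to itself. A $\mathbb Z_p$-combinatorial sphere is a combinatorial sphere with a free simplicial $\mathbb Z_p$-action. $\mathbb Z_p$ acts on a join diagonally, $g\cdot(\sigma\sqcup\tau)=g\cdot\sigma\sqcup g\cdot\tau$, and on $\operatorname{Bd}^k$ by $g\cdot v_\sigma=v_{g\cdot\sigma}$. A simplicial map $f$ is $\mathbb Z_p$-equivariant if $f(g\cdot\sigma)=g\cdot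 f(\sigma)$ for all $g,\sigma$. *)

(* Defs.v *)
From HB Require Import structures.
From mathcomp Require Import all_boot all_order all_algebra all_fingroup.

Set Implicit Arguments.
Unset Strict Implicit.
Unset Printing Implicit Defensive.

(* A complex is a set of finite sets of elements of a finite ambient type T;
   an element of T need not be a vertex of the complex. *)

Section Complexes.
Variable T : finType.
Implicit Types (K L : {set {set T}}) (s t : {set T}) (d : nat).

Definition is_complex K : Prop :=
  set0 \in K /\ (forall s t, s \in K -> t \subset s -> t \in K).

Definition vertices K : {set T} := cover K.

(* Integer-valued, so that the empty simplex has dimension -1. *)
Definition sdim s : int := (#|s|%:Z - 1)%R.

Definition facet s t : bool := (s \subset t) && (sdim s == (sdim t - 1)%R).

Definition pseudomanifold d K : Prop :=
  [/\ is_complex K,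
      forall s, maxset (mem K) s -> sdim s = d,
      forall s, s \in K -> sdim s = (d%:Z - 1)%R ->
        #|[set t in K | (sdim t == d) && (s \subset t)]| = 2
    & forall s t, s \in K -> t \in K -> sdim s = d -> sdim t = d ->
        connect [rel u v : {set T} |
                   [&& u \in K, v \in K, sdim u == d, sdim v == d
                     & sdim (u :&: v) == (d%:Z - 1)%R]] s t].

Definition discrete_vector_field K (V : {set {set T} * {set T}}) : Prop :=
  (forall s t, (s, t) \in V -> [/\ s \in K, t \in K & facet s t]) /\
  (forall s, #|[set st in V | (st.1 == s) || (st.2 == s)]| <= 1).

(* The trajectory b, a_1, b_1, ..., a_r, b_r is given by its first term b and
   the sequence r of pairs (a_i, b_i). *)
Fixpoint trajectory K (V : {set {set T} * {set T}}) (q : int)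
    (b : {set T}) (r : seq ({set T} * {set T})) : bool :=
  [&& b \in K, sdim b == q &
    if r is (a, b') :: r' then
      [&& sdim a == (q - 1)%R, (a, b') \in V, a \proper b, b != b'
        & trajectory K V q b' r']
    else true].

Definition gradient_vector_field K V : Prop :=
  discrete_vector_field K V /\
  forall q b r, trajectory K V q b r -> r <> [::] -> last b (unzip2 r) <> b.

Definition critical K (V : {set {set T} * {set T}}) s : bool :=
  [&& s \in K, s != set0 &
    [forall st in V, (st.1 != s) && (st.2 != s)]
    || (sdim s == 0%R) && ((set0, s) \in V)].

Definition combinatorial_sphere d K : Prop :=
  pseudomanifold d K /\
  exists V, gradient_vector_field K V /\
    exists s t, [/\ s <> t, sdim s = d, sdim t = 0%R
                  & [set u | critical K V u] = [set s; t]].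

(* The join of complexes, when their vertex sets are disjoint. *)
Definition cjoin K L : {set {set T}} := [set s :|: t | s in K, t in L].

Definition iterated_join m (S : 'I_m -> {set {set T}}) : {set {set T}} :=
  \big[cjoin/[set set0]]_(i < m) S i.

(* The vertex v_s of the barycentric subdivision is represented by s. *)
Definition Bd K : {set {set {set T}}} :=
  [set c : {set {set T}} |
    [forall s in c, (s \in K) && (s != set0)] &&
    [forall s in c, forall t in c, (s \subset t) || (t \subset s)]].

End Complexes.

(* The apex of the cone is None. *)
Definition cone (T : finType) (K : {set {set T}}) : {set {set option T}} :=
  cjoin [set set0; [set None]] [set Some @: s | s : {set T} in K].

Fixpoint bd_type (T : finType) (k : nat) : finType :=
  if k is k'.+1 then {set bd_type T k'} : finType else T.

Fixpoint iterated_Bd (T : finType) (K : {set {set T}}) (k : nat) :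
    {set {set bd_type T k}} :=
  match k return {set {set bd_type T k}} with
  | 0 => K
  | k'.+1 => Bd (iterated_Bd K k')
  end.

Definition simplicial_map (T U : finType) (K : {set {set T}})
    (L : {set {set U}}) (f : T -> U) : Prop :=
  forall s, s \in K -> f @: s \in L.

(* Actions are written on the right, as in the library; this is immaterial
   for the abelian group 'Z_p. *)

(* Every action on the vertices of K is the restriction of an action on T
   (trivial on the elements of T that are not vertices). *)
Definition free_simplicial_action (p : nat) (T : finType) (K : {set {set T}})
    (to : {action 'Z_p &-> T}) : Prop :=
  (forall g, simplicial_map K K (to^~ g)) /\
  (forall g s, g <> 1%g -> s \in K -> s <> set0 -> [set to v g | v in s] <> s).

Definition Zp_combinatorial_sphere (p : nat) (T : finType) (K : {set {set T}})
    (to : {action 'Z_p &-> T}) : Prop :=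
  (exists d, combinatorial_sphere d K) /\ free_simplicial_action K to.

(* The diagonal action on the vertices of a join: g acts on a vertex of S i
   through the i-th action.  Vertex sets are meant to be disjoint; elements of
   T outside all of them are fixed. *)
Definition diagonal_act (p : nat) (T : finType) m (S : 'I_m -> {set {set T}})
    (to : 'I_m -> {action 'Z_p &-> T}) (v : T) (g : 'Z_p) : T :=
  if [pick i | v \in vertices (S i)] is Some i then to i v g else v.

Fixpoint bd_act (p : nat) (T : finType) (a : T -> 'Z_p -> T) (k : nat) :
    bd_type T k -> 'Z_p -> bd_type T k :=
  match k return bd_type T k -> 'Z_p -> bd_type T k with
  | 0 => a
  | k'.+1 => fun (s : {set bd_type T k'}) g => [set bd_act a v g | v in s]
  end.

Definition equivariant (p : nat) (T U : finType) (K : {set {set T}})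
    (a : T -> 'Z_p -> T) (b : U -> 'Z_p -> U) (f : T -> U) : Prop :=
  forall g s, s \in K ->
    f @: [set a v g | v in s] = [set b w g | w in f @: s].

(* Main.v *)
Require Import Defs.
From HB Require Import structures.
From mathcomp Require Import all_boot all_order all_algebra all_fingroup.
From mathcomp Require Import pgroup sylow.

(* Write K for the join, augmented chains being taken over F_p. Subdividing and
   then applying f gives an equivariant chain endomorphism phi of C(K). The
   cone supplies a null-homotopy phi = bh + hb, where h is "subdivide, apply f,
   then join with f(x)"; hence the alternating sum of the traces of phi
   vanishes. On the other hand Z_p permutes the nonempty simplices of K in
   orbits of length p along which the diagonal coefficients of phi are
   constant, so these contribute 0 mod p, while the empty simplex
   contributes 1. *)

Set Implicit Arguments.
Unset Strict Implicit.
Unset Printing Implicit Defensive.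

Import GRing.Theory.

(** * Free modules of chains on a finite set *)

Section FreeModule.
Local Open Scope ring_scope.
Variable R : comNzRingType.
Local Notation chain A := {ffun A -> R^o}.

Definition delta (A : finType) (a : A) : chain A := [ffun b => (b == a)%:R].

Definition lext (A : finType) (V : lmodType R) (b : A -> V) (x : chain A) : V :=
  \sum_a (x a : R) *: b a.

Lemma lext_is_linear A V b : linear (@lext A V b).
Proof.
move=> k x y; rewrite /lext scaler_sumr -big_split /=.
by apply: eq_bigr => a _; rewrite !ffunE scalerDl scalerA.
Qed.

HB.instance Definition _ (A : finType) (V : lmodType R) (b : A -> V) :=
  GRing.isLinear.Build R (chain A) V _ (@lext A V b) (@lext_is_linear A V b).

Lemma lext_delta (A : finType) (V : lmodType R) (b : A -> V) a :
  lext b (delta a) = b a.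
Proof.
rewrite /lext (bigD1 a) //= big1 ?addr0 => [|c /negbTE nca].
  by rewrite ffunE eqxx scale1r.
by rewrite ffunE nca scale0r.
Qed.

Lemma chain_sum (A : finType) (x : chain A) : x = \sum_a (x a : R) *: delta a.
Proof.
apply/ffunP=> a; rewrite sum_ffunE (bigD1 a) //= big1 ?addr0 => [|c nca].
  by rewrite !ffunE eqxx; exact/esym/mulr1.
by rewrite !ffunE eq_sym (negbTE nca); exact: mulr0.
Qed.

(** Chains of a complex get no type of their own: they are the chains on all subsets that vanish off
    the complex. Each operator is thus defined once, and preserving a complex becomes a statement
    about supports. *)
Definition supp (A : finType) (K : {pred A}) (x : chain A) :=
  forall a, a \notin K -> x a = 0.

Lemma suppP (A : finType) (K : {pred A}) (P : chain A -> Prop) :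
  P 0 -> (forall k x y, P x -> P y -> P (k *: x + y)) ->
  (forall a, a \in K -> P (delta a)) -> forall x, supp K x -> P x.
Proof.
move=> P0 PD Pd x Kx; rewrite [x]chain_sum; elim: index_enum => [|a r IH].
  by rewrite big_nil.
rewrite big_cons; have [Ka|/Kx->] := boolP (a \in K); first exact/PD/IH/Pd.
by rewrite scale0r add0r.
Qed.

Lemma chainP (A : finType) (P : chain A -> Prop) :
  P 0 -> (forall k x y, P x -> P y -> P (k *: x + y)) ->
  (forall a, P (delta a)) -> forall x, P x.
Proof. by move=> P0 PD Pd x; apply: (@suppP A predT). Qed.

Lemma supp0 (A : finType) (K : {pred A}) : supp K 0.
Proof. by move=> a _; rewrite ffunE. Qed.

Lemma suppD (A : finType) (K : {pred A}) k x y :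
  supp K x -> supp K y -> supp K (k *: x + y).
Proof.
by move=> Kx Ky a nKa; rewrite !ffunE Kx ?Ky // addr0; exact: mulr0.
Qed.

Lemma suppZ (A : finType) (K : {pred A}) k x : supp K x -> supp K (k *: x).
Proof. by move=> Kx a nKa; rewrite !ffunE Kx //; exact: mulr0. Qed.

Lemma supp_delta (A : finType) (K : {pred A}) a : a \in K -> supp K (delta a).
Proof. by move=> Ka b; rewrite ffunE; case: eqP => // ->; rewrite Ka. Qed.

Lemma supp_lext (A B : finType) (K : {pred A}) (L : {pred B})
    (b : A -> chain B) x :
  supp K x -> (forall a, a \in K -> supp L (b a)) -> supp L (lext b x).
Proof.
move=> Kx Lb; move: x Kx; apply: suppP => [|k x y Lx Ly|a Ka].
- by rewrite linear0; apply: supp0.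
- by rewrite linearP; apply: suppD.
- by rewrite lext_delta; apply: Lb.
Qed.

End FreeModule.

(** * The exterior algebra of chains on all subsets *)

Lemma setD1_ind (T : finType) (P : {set T} -> Prop) :
  P set0 -> (forall s, s != set0 -> (forall v, v \in s -> P (s :\ v)) -> P s) ->
  forall s, P s.
Proof.
move=> P0 PD s; move: {2}#|s| (erefl #|s|) => n.
elim: n s => [|n IH] s cs; first by rewrite (cards0_eq cs).
apply: PD => [|v vs]; first by rewrite -card_gt0 cs.
by apply: IH; move: cs; rewrite (cardsD1 v) vs => -[].
Qed.

(* Chains on all subsets of T form the exterior algebra on T: [wedge v] is left
   multiplication by v, [bound] is the contraction with the augmentation, and
   [push f] is the algebra map induced by f. *)
Section Exterior.
Local Open Scope ring_scope.
Variable R : comNzRingType.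
Local Notation chain A := {ffun A -> R^o}.
Local Notation "[ 'e' s ]" := (delta R s).

(** Only elements strictly before [v] in the enumeration count, so the same sign serves for
    inserting [v] into [s] and for deleting it. *)
Definition sgn (T : finType) (v : T) (s : {set T}) : R :=
  (-1) ^+ count (mem s) (take (index v (enum T)) (enum T)).

Definition wedge (T : finType) (v : T) : chain {set T} -> chain {set T} :=
  lext (fun s : {set T} => if v \in s then 0 else sgn v s *: delta R (v |: s)).

Definition bound (T : finType) : chain {set T} -> chain {set T} :=
  lext (fun s : {set T} => \sum_(v in s) sgn v s *: delta R (s :\ v)).

HB.instance Definition _ (T : finType) (v : T) := GRing.Linear.on (wedge v).
HB.instance Definition _ (T : finType) := GRing.Linear.on (@bound T).

Section Relations.
Variable T : finType.
Implicit Types (s t : {set T}) (u v w : T).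

Lemma sgn_sqr v s : sgn v s * sgn v s = 1.
Proof. by rewrite -expr2 sqrr_sign. Qed.

Let before u v := (index u (enum T) < index v (enum T))%N.

Lemma before_asym u v : u != v -> before v u = ~~ before u v.
Proof.
move=> neq; rewrite /before -leqNgt [RHS]leq_eqVlt.
case: eqP => // eqi; case/eqP: neq.
by rewrite -(@nth_index _ u v (enum T)) ?mem_enum // eqi nth_index ?mem_enum.
Qed.

Lemma sgnU1 v w s : w \notin s ->
  sgn v (w |: s) = (-1) ^+ before w v * sgn v s.
Proof.
move=> nws; rewrite /sgn -exprD; congr (_ ^+ _).
set l := take _ _.
have ul : uniq l by rewrite take_uniq ?enum_uniq.
have -> : before w v = count_mem w l :> nat.
  by rewrite count_uniq_mem // in_take ?mem_enum.
rewrite -count_predUI addnC [X in (X + _)%N](_ : _ = 0%N) ?add0n.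
  by apply: eq_count => x; rewrite !inE.
apply/eqP; rewrite -leqn0 leqNgt -has_count; apply/hasPn => x _ /=.
by apply/negP => /andP[/eqP->]; apply/negP.
Qed.

Lemma sgnU1_id v s : sgn v (v |: s) = sgn v s.
Proof.
have [vs|nvs] := boolP (v \in s); first by rewrite (setUidPr _) ?sub1set.
by rewrite sgnU1 // /before ltnn mul1r.
Qed.

Lemma wedge_delta v s :
  wedge v [e s] = if v \in s then 0 else sgn v s *: [e v |: s].
Proof. exact: lext_delta. Qed.

Lemma bound_delta s : bound [e s] = \sum_(v in s) sgn v s *: [e s :\ v].
Proof. exact: lext_delta. Qed.

Lemma delta_wedge v s : v \in s -> [e s] = sgn v s *: wedge v [e s :\ v].
Proof.
move=> vs; rewrite wedge_delta !inE eqxx /= -(sgnU1_id v (s :\ v)) setD1K //.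
by rewrite scalerA sgn_sqr scale1r.
Qed.

(** By [delta_wedge] the left multiplications generate everything from the unit. For identities
    proved this way, the only signs left are those in the commutation rules of the operators with
    [wedge]. *)
Lemma exteriorP (P : chain {set T} -> Prop) :
  P 0 -> (forall k x y, P x -> P y -> P (k *: x + y)) ->
  P [e set0] -> (forall v x, P x -> P (wedge v x)) -> forall x, P x.
Proof.
move=> P0 PD Pe Pw; apply: chainP => //; elim/setD1_ind=> // s /set0Pn[v vs] IH.
rewrite (delta_wedge vs) -[_ *: _]addr0; apply: PD => //; exact/Pw/IH.
Qed.

(** Of two distinct elements exactly one precedes the other, so exactly one of the two orders of
    insertion picks up an extra factor -1. *)
Lemma wedgeC v w x : wedge v (wedge w x) = - wedge w (wedge v x).
Proof.
elim/chainP: x => [|k x y Hx Hy|s]; first by rewrite !linear0.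
  by rewrite !linearP /= Hx Hy.
rewrite !wedge_delta.
have [ws|nws] := boolP (w \in s); have [vs|nvs] := boolP (v \in s).
- by rewrite !linear0.
- by rewrite linear0 linearZ /= wedge_delta !inE ws orbT scaler0 oppr0.
- by rewrite linear0 linearZ /= wedge_delta !inE vs orbT scaler0 oppr0.
rewrite !linearZ /= !wedge_delta !inE (negbTE nws) (negbTE nvs) !orbF.
have [->|nvw] := eqVneq v w; first by rewrite oppr0 !scaler0.
rewrite scalerN !sgnU1 // setUCA !scalerA -scaleNr; congr (_ *: _).
rewrite (before_asym nvw).
by case: before; rewrite ?expr0 ?expr1 ?mul1r ?mulN1r ?mulrN ?opprK mulrC.
Qed.

Lemma wedge_wedge v x : wedge v (wedge v x) = 0.
Proof.
elim/chainP: x => [|k x y Hx Hy|s]; first by rewrite !linear0.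
  by rewrite !linearP /= Hx Hy scaler0 addr0.
rewrite wedge_delta; case: ifP => vs; first by rewrite linear0.
by rewrite linearZ /= wedge_delta !inE eqxx scaler0.
Qed.

(** Contraction is an antiderivation with value 1 on each generator; equivalently, [wedge v]
    contracts the augmented complex of all chains. *)
Lemma bound_wedge v x : bound (wedge v x) = x - wedge v (bound x).
Proof.
elim/chainP: x => [|k x y Hx Hy|s]; first by rewrite !linear0 addr0.
  by rewrite !linearP /= Hx Hy scalerDr addrACA.
rewrite bound_delta (linear_sum (wedge v)) wedge_delta /=; case: ifPn => vs.
  (* The left side vanishes, and [wedge v] kills every term of the boundary except the one that lost
     [v], which it turns back into [s]. *)
  rewrite linear0 (bigD1 v) //= big1 ?addr0 => [|u /andP[us nuv]].
    by rewrite linearZ /= -(delta_wedge vs) subrr.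
  by rewrite linearZ /= wedge_delta !inE eq_sym nuv vs scaler0.
(* Deleting [v] again returns [s]; each other term matches a term of [wedge v] applied to the
   boundary of [s], with the opposite sign. *)
rewrite linearZ /= bound_delta big_setU1 //= scalerDr scalerA sgnU1_id sgn_sqr.
rewrite scale1r setU1K //; congr (_ + _); rewrite scaler_sumr -sumrN.
apply: eq_bigr => u us; have nuv : u != v by apply: contraNneq vs => <-.
rewrite [wedge _ _]linearZ /= wedge_delta !inE (negbTE vs) andbF.
rewrite !scalerA -scaleNr.
have -> : (v |: s) :\ u = v |: s :\ u.
  by apply/setP=> x; rewrite !inE; case: eqP => //= ->; rewrite (negbTE nuv).
congr (_ *: _).
rewrite sgnU1 // -{1}(setD1K us) sgnU1 ?inE ?eqxx // (before_asym nuv).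
by case: before; rewrite ?expr0 ?expr1 !(mul1r, mulN1r, mulrN, mulNr) mulrC.
Qed.

Lemma bound_bound (x : chain {set T}) : bound (bound x) = 0.
Proof.
elim/exteriorP: x => [|k x y Hx Hy||v x Hx]; first by rewrite !linear0.
- by rewrite !linearP /= Hx Hy scaler0 addr0.
- by rewrite bound_delta big_set0 linear0.
- by rewrite bound_wedge linearB /= bound_wedge Hx linear0 subr0 subrr.
Qed.

Lemma supp_wedge (K L : {pred {set T}}) v x :
  supp K x -> (forall s, s \in K -> v |: s \in L) -> supp L (wedge v x).
Proof.
move=> Kx KL; apply: (supp_lext Kx) => s Ks; case: ifP => _; first exact: supp0.
by apply: suppZ; apply/supp_delta/KL.
Qed.

Lemma supp_bound (K : {set {set T}}) (x : chain {set T}) :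
  is_complex K -> supp (mem K) x -> supp (mem K) (bound x).
Proof.
case=> _ Kdown Kx; apply: (supp_lext Kx) => s Ks; apply: big_ind => [||v _].
- exact: supp0.
- by move=> y z Ky Kz; rewrite -[y]scale1r; apply: suppD.
- apply/suppZ/supp_delta.
  exact: Kdown Ks (subD1set _ _).
Qed.

End Relations.

(** A simplex goes to the product of the images of its vertices in enumeration order. Simplices
    collapsed by [f] are sent to 0 without a case distinction, a repeated factor making the product
    vanish. *)
Definition push (T U : finType) (f : T -> U) :
    chain {set T} -> chain {set U} :=
  lext (fun s : {set T} =>
    foldr (fun v => wedge (f v)) (delta R (set0 : {set U})) (enum s)).

HB.instance Definition _ (T U : finType) (f : T -> U) :=
  GRing.Linear.on (push f).

Lemma push_delta0 (T U : finType) (f : T -> U) : push f [e set0] = [e set0].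
Proof. by rewrite /push lext_delta enum_set0. Qed.

Lemma push_setU1 (T U : finType) (f : T -> U) v (s : {set T}) : v \notin s ->
  push f [e v |: s] = sgn v s *: wedge (f v) (push f [e s]).
Proof.
have enumE (t : {set T}) : enum t = filter (mem t) (enum T) by rewrite enumT.
move=> vs; rewrite /push !lext_delta /sgn !enumE.
(* Split the enumeration at [v]: the factor [f v] has to pass the elements of [s] lying in [r1],
   each costing a sign, and their number is the exponent in [sgn v s]. *)
have /splitPr : v \in enum T by rewrite mem_enum.
have := enum_uniq T; move: (enum T) => r ur splr.
case: splr ur => r1 r2; rewrite cat_uniq /= negb_or.
case/and3P=> _ /andP[vr1 _] /andP[vr2 _].
rewrite index_cat (negbTE vr1) /= eqxx addn0 take_size_cat //.
rewrite !filter_cat /= !inE eqxx (negbTE vs) /=.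
have E q : v \notin q -> filter (mem (v |: s)) q = filter (mem s) q.
  move=> vq; apply: eq_in_filter => u uq /=; rewrite !inE.
  by case: eqP uq => // ->; rewrite (negbTE vq).
rewrite (E r1) // (E r2) // -size_filter !foldr_cat /=.
elim: (filter _ r1) => [|u q IH] /=; first by rewrite scale1r.
by rewrite IH linearZ /= wedgeC exprS mulN1r scalerN scaleNr.
Qed.

Lemma push_wedge (T U : finType) (f : T -> U) v x :
  push f (wedge v x) = wedge (f v) (push f x).
Proof.
elim/chainP: x => [|k x y Hx Hy|s]; first by rewrite !linear0.
  by rewrite !linearP /= Hx Hy.
have notin (t : {set T}) : v \notin t ->
    push f (wedge v [e t]) = wedge (f v) (push f [e t]).
  move=> vt; rewrite wedge_delta (negbTE vt) linearZ /= push_setU1 // scalerA.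
  by rewrite sgn_sqr scale1r.
have [vs|] := boolP (v \in s); last exact: notin.
rewrite wedge_delta vs linear0 (delta_wedge vs) !linearZ /= notin ?inE ?eqxx //.
by rewrite wedge_wedge scaler0.
Qed.

Lemma push_bound (T U : finType) (f : T -> U) x :
  bound (push f x) = push f (bound x).
Proof.
elim/exteriorP: x => [|k x y Hx Hy||v x Hx]; first by rewrite !linear0.
- by rewrite !linearP /= Hx Hy.
- by rewrite push_delta0 !bound_delta !big_set0 linear0.
- by rewrite push_wedge !bound_wedge Hx linearB /= push_wedge.
Qed.

Lemma push_comp (T U W : finType) (f : U -> W) (g : T -> U) x :
  push f (push g x) = push (f \o g) x.
Proof.
elim/exteriorP: x => [|k x y Hx Hy||v x Hx]; first by rewrite !linear0.
- by rewrite !linearP /= Hx Hy.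
- by rewrite !push_delta0.
- by rewrite !push_wedge Hx.
Qed.

Lemma eq_push (T U : finType) (f g : T -> U) (s : {set T}) :
  {in s, f =1 g} -> push f [e s] = push g [e s].
Proof.
move=> fg; rewrite /push !lext_delta.
have: {subset enum s <= s} by move=> v; rewrite mem_enum.
elim: (enum s) => //= v r IH vr; rewrite IH ?fg ?vr ?mem_head // => u ur.
by apply: vr; rewrite inE ur orbT.
Qed.

(** For injective [f] no factor repeats, so the coefficient is a product of signs; this is recorded
    as [c * c = 1], the form in which it can be cancelled. *)
Lemma push_deltaP (T U : finType) (f : T -> U) (s : {set T}) :
  exists c : R, push f [e s] = c *: [e f @: s] /\ (injective f -> c * c = 1).
Proof.
elim/setD1_ind: s => [|s /set0Pn[v vs] IH].
  by exists 1; rewrite push_delta0 imset0 scale1r mulr1.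
have [c [Hc c1]] := IH v vs.
rewrite (delta_wedge vs) linearZ /= push_wedge Hc linearZ /= wedge_delta.
rewrite -imsetU1 setD1K //; case: ifPn => fv.
  exists 0; rewrite !scaler0 scale0r; split=> // inj_f; move: fv.
  by rewrite (mem_imset _ _ inj_f) !inE eqxx.
exists (sgn v (s :\ v) * c * sgn (f v) (f @: (s :\ v))).
rewrite !scalerA; split=> [|/c1 {}c1].
  by congr (_ * _ * _ *: _); rewrite -(sgnU1_id v (s :\ v)) setD1K.
by rewrite mulrACA sgn_sqr mulr1 mulrACA sgn_sqr c1 mulr1.
Qed.

Lemma supp_push (T U : finType) (f : T -> U) (K : {pred {set T}})
    (L : {pred {set U}}) x :
  supp K x -> (forall s, s \in K -> f @: s \in L) -> supp L (push f x).
Proof.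
move=> Kx KL; apply: (supp_lext Kx) => s /KL Ls.
have [c []] := push_deltaP f s; rewrite /push lext_delta => -> _.
by apply: suppZ; apply: supp_delta.
Qed.

End Exterior.

(** * Barycentric subdivision of chains *)

Section Subdivision.
Local Open Scope ring_scope.
Variable R : comNzRingType.
Local Notation chain A := {ffun A -> R^o}.
Local Notation "[ 'e' s ]" := (delta R s).

(* sd(s) = v_s * sd(boundary of s), with fuel [n] equal to the cardinality of
   [s]. *)
Fixpoint sd_simplex (T : finType) (n : nat) (s : {set T}) :
    chain {set {set T}} :=
  if n is n'.+1 then wedge s (lext (sd_simplex n') (bound [e s])) else [e set0].

Definition sd (T : finType) : chain {set T} -> chain {set {set T}} :=
  lext (fun s : {set T} => sd_simplex #|s| s).

HB.instance Definition _ (T : finType) := GRing.Linear.on (@sd T).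

(** Supplies the inductive step for identities about [sd], which is defined by recursion through the
    boundary. *)
Lemma eq_bound (T : finType) (V : lmodType R)
    (F G : {linear chain {set T} -> V}) (s : {set T}) :
  (forall v, v \in s -> F [e s :\ v] = G [e s :\ v]) ->
  F (bound [e s]) = G (bound [e s]).
Proof.
move=> FG; rewrite bound_delta !linear_sum; apply: eq_bigr => v vs.
by rewrite !linearZ FG.
Qed.

Section OneComplex.
Variable T : finType.
Implicit Types (s t : {set T}) (v : T) (x : chain {set T}).

Lemma sd_delta0 : sd [e set0 : {set T}] = [e set0].
Proof. by rewrite /sd lext_delta cards0. Qed.

(** The recursion freed of its fuel: each term of the boundary has one element fewer, so the
    remaining fuel is again its cardinality. *)
Lemma sd_delta s : s != set0 -> sd [e s] = wedge s (sd (bound [e s])).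
Proof.
rewrite -card_gt0 /sd lext_delta => s0; rewrite -(prednK s0) /=; congr wedge.
rewrite bound_delta !linear_sum; apply: eq_bigr => v vs /=.
rewrite !linearZ /= !lext_delta; congr (_ *: sd_simplex _ _).
by rewrite (cardsD1 v) vs.
Qed.

(** The boundary of the cone with apex [s] over [sd (bound [e s])] is its base minus the cone over
    the boundary of the base; by induction the latter is the cone over [sd (bound (bound [e s]))],
    which is 0. *)
Lemma bound_sd x : bound (sd x) = sd (bound x).
Proof.
elim/chainP: x => [|k x y Hx Hy|s]; first by rewrite !linear0.
  by rewrite !linearP /= Hx Hy.
elim/setD1_ind: s => [|s s0 IH].
  by rewrite sd_delta0 !bound_delta !big_set0 linear0.
rewrite sd_delta // bound_wedge.
have -> : bound (sd (bound [e s])) = sd (bound (bound [e s])).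
  exact: (eq_bound (F := @bound R _ \o @sd _) (G := @sd _ \o @bound R _)).
by rewrite bound_bound !linear0 addr0.
Qed.

Lemma supp_sd (K : {set {set T}}) x :
  is_complex K -> supp (mem K) x -> supp (mem (Bd K)) (sd x).
Proof.
case=> _ Kdown Kx; apply: (supp_lext Kx) => s Ks.
(* The induction needs that all members of the occurring flags lie inside [s], so that adding [s]
   itself leaves a flag. *)
pose B s : {set {set {set T}}} :=
  [set c in Bd K | [forall t in c, t \subset s]].
suff: supp (mem (B s)) (sd [e s]).
  rewrite /sd lext_delta => Bs c nc; apply: Bs; apply: contra nc.
  by rewrite !inE => /andP[].
elim/setD1_ind: s Ks => [_|s s0 IH Ks].
  rewrite sd_delta0; apply: supp_delta; rewrite !inE.
  by apply/andP; split; first (apply/andP; split);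
    apply/forall_inP => t; rewrite inE.
rewrite sd_delta //.
have: supp (mem (B s)) (sd (bound [e s])).
  rewrite bound_delta linear_sum; apply: big_ind => [||v vs].
  - exact: supp0.
  - by move=> y z By Bz; rewrite -[y]scale1r; apply: suppD.
  - rewrite linearZ /=; apply: suppZ.
    have Ksv := Kdown _ _ Ks (subD1set s v).
    move=> c nc; apply: (IH v vs Ksv); apply: contra nc.
    rewrite !inE => /andP[-> /forall_inP cs]; apply/forall_inP => t /cs.
    by move=> /subset_trans-> //; apply: subD1set.
move/supp_wedge; apply => c; rewrite !inE => /andP[/andP[/forall_inP c1]].
move=> /forall_inP c2 /forall_inP c3; apply/andP; split; last first.
  by apply/forall_inP => t /setU1P[->//|/c3].
apply/andP; split; apply/forall_inP => t /setU1P[->|tc]; rewrite ?Ks ?c1 //.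
  by apply/forall_inP => u /setU1P[->|/c3->]; rewrite ?subxx ?orbT.
apply/forall_inP => u /setU1P[->|uc]; first by rewrite c3.
by have /forall_inP/(_ u uc) := c2 t tc.
Qed.

End OneComplex.

(** The image of [s] is a multiple of the simplex [a @: s], whose subdivision is a cone with apex
    [a @: s], the image of the apex [s]; the bases agree by induction. *)
Lemma push_sd (T U : finType) (a : T -> U) (x : chain {set T}) :
  injective a ->
  sd (push a x) = push (fun s : {set T} => a @: s) (sd x).
Proof.
move=> inj_a.
elim/chainP: x => [|k x y Hx Hy|s]; first by rewrite !linear0.
  by rewrite !linearP /= Hx Hy.
elim/setD1_ind: s => [|s s0 IH]; last rewrite sd_delta //.
  by rewrite push_delta0 !sd_delta0 push_delta0.
have [c [Ec _]] := push_deltaP R a s.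
rewrite push_wedge.
have -> : sd (push a [e s]) = wedge (a @: s) (sd (bound (push a [e s]))).
  by rewrite Ec !linearZ /= -sd_delta // -card_gt0 card_imset // card_gt0.
rewrite push_bound; congr wedge.
exact: (eq_bound (F := @sd _ \o push a) (G := push _ \o @sd _)).
Qed.

Fixpoint iterated_sd (T : finType) (k : nat) :
    chain {set T} -> chain {set bd_type T k} :=
  match k with
  | 0 => id
  | k'.+1 => fun x => sd (iterated_sd k' x)
  end.

Lemma iterated_sd_is_linear T k : linear (@iterated_sd T k).
Proof. by elim: k => [|k IH] c x y //=; rewrite IH linearP. Qed.

HB.instance Definition _ (T : finType) (k : nat) :=
  GRing.isLinear.Build R (chain {set T}) (chain {set bd_type T k}) _
    (@iterated_sd T k) (@iterated_sd_is_linear T k).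

Section Iterate.
Variables (T : finType) (k : nat).

Lemma iterated_sd_delta0 : iterated_sd k [e set0 : {set T}] = [e set0].
Proof. by elim: k => //= k' ->; rewrite sd_delta0. Qed.

Lemma bound_iterated_sd (x : chain {set T}) :
  bound (iterated_sd k x) = iterated_sd k (bound x).
Proof. by elim: k => //= k' <-; rewrite bound_sd. Qed.

End Iterate.

Lemma Bd_complex (T : finType) (K : {set {set T}}) : is_complex (Bd K).
Proof.
split=> [|c d]; rewrite !inE.
  by apply/andP; split; apply/forall_inP => t; rewrite inE.
case/andP=> /forall_inP c1 /forall_inP c2 /subsetP dc.
apply/andP; split; apply/forall_inP => t /dc tc; first exact: c1.
by apply/forall_inP => u /dc uc; have /forall_inP/(_ u uc) := c2 t tc.
Qed.

Lemma iterated_Bd_complex (T : finType) (K : {set {set T}}) k :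
  is_complex K -> is_complex (iterated_Bd K k).
Proof. by case: k => //= k _; apply: Bd_complex. Qed.

Lemma supp_iterated_sd (T : finType) (K : {set {set T}}) k x :
  is_complex K -> supp (mem K) x ->
  supp (mem (iterated_Bd K k)) (iterated_sd k x).
Proof.
move=> cK Kx; elim: k => //= k IH.
by apply: supp_sd => //; apply: iterated_Bd_complex.
Qed.

Lemma bd_act_inj p (T : finType) (a : T -> 'Z_p -> T) k g :
  injective (a^~ g) -> injective ((@bd_act p T a k)^~ g).
Proof. by move=> inj_a; elim: k => //= k IH; apply: imset_inj. Qed.

Lemma push_iterated_sd p (T : finType) (a : T -> 'Z_p -> T) k g
    (x : chain {set T}) :
  injective (a^~ g) ->
  iterated_sd k (push (a^~ g) x) =
  push ((@bd_act p T a k)^~ g) (iterated_sd k x).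
Proof.
move=> inj_a; elim: k => //= k ->.
by rewrite push_sd //; apply: bd_act_inj.
Qed.

End Subdivision.

(** * Traces, and counting modulo p *)

Section Trace.
Local Open Scope ring_scope.

Lemma linear_coef (R : comNzRingType) (A B : finType)
    (f : {linear {ffun A -> R^o} -> {ffun B -> R^o}}) x b :
  f x b = \sum_a x a * f (delta R a) b :> R.
Proof.
rewrite {1}[x]chain_sum linear_sum sum_ffunE; apply: eq_bigr => a _.
by rewrite linearZ ffunE.
Qed.

Lemma bound_coef (R : comNzRingType) (T : finType) (s t : {set T}) :
  #|t| != #|s|.+1 -> bound (delta R t) s = 0.
Proof.
move=> ts; rewrite bound_delta sum_ffunE big1 // => v vt; rewrite !ffunE.
case: eqP => [E|_]; last exact: mulr0.
by case/eqP: ts; rewrite E (cardsD1 v) vt.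
Qed.

(* Lefschetz number of a null-homotopic map: tr(AB) = tr(BA), and the sign
   changes because the boundary has degree -1. *)
Lemma supertrace_homotopy (R : comNzRingType) (T : finType)
    (K : {set {set T}})
    (h : {linear {ffun {set T} -> R^o} -> {ffun {set T} -> R^o}}) :
  is_complex K -> (forall x, supp (mem K) x -> supp (mem K) (h x)) ->
  \sum_(s in K) (-1) ^+ #|s| *
    (bound (h (delta R s)) + h (bound (delta R s))) s = 0 :> R.
Proof.
move=> cK hK.
have coefK (f : {linear {ffun {set T} -> R^o} -> {ffun {set T} -> R^o}}) x s :
    supp (mem K) x -> f x s = \sum_(t in K) x t * f (delta R t) s :> R.
  move=> Kx; rewrite linear_coef [RHS]big_mkcond; apply: eq_bigr => t _.
  by case: ifPn => // /Kx->; rewrite mul0r.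
have Kd s : s \in K -> supp (mem K) (delta R s) by apply: supp_delta.
transitivity (\sum_(s in K) \sum_(t in K)
    ((-1) ^+ #|s| * (h (delta R s) t * bound (delta R t) s) +
     (-1) ^+ #|s| * (bound (delta R s) t * h (delta R t) s)) : R).
  apply: eq_bigr => s Ks; rewrite big_split /= -!mulr_sumr -mulrDr ffunE.
  rewrite (coefK (@bound R T)) ?(coefK h) //.
    exact/supp_bound/Kd.
  exact/hK/Kd.
under eq_bigr do rewrite big_split.
rewrite big_split /= [X in _ + X]exchange_big -big_split big1 //= => s Ks.
rewrite -big_split big1 //= => t Kt.
have [ts|/bound_coef->] := eqVneq #|t| #|s|.+1; last first.
  by rewrite !(mul0r, mulr0) addr0.
by rewrite ts exprS mulN1r mulNr (mulrC (bound _ _)) subrr.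
Qed.

(** Each level set of [F] is stable under the p-group and contains no point fixed by all of it, so
    its cardinality is divisible by p and its constant value contributes 0. *)
Lemma sum_fixfree (p : nat) (gT : finGroupType) (G : {group gT}) (A : finType)
    (to : {action gT &-> A}) (K : {set A}) (F : A -> 'F_p) :
  prime p -> pgroup p G ->
  (forall g a, g \in G -> a \in K -> to a g \in K /\ F (to a g) = F a) ->
  (forall a, a \in K -> exists2 g, g \in G & to a g != a) ->
  \sum_(a in K) F a = 0.
Proof.
move=> pr_p pG GK nofix; rewrite (partition_big F predT) //=.
apply: big1 => c _; rewrite (eq_bigr (fun=> c)) => [|a /andP[_ /eqP]//].
rewrite sumr_const -mulr_natr.
pose S := [set a in K | F a == c].
have -> : #|[pred a | (a \in K) && (F a == c)]| = #|S|.
  by apply: eq_card => a; rewrite !inE.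
have actsS : [acts G, on S | to].
  apply/subsetP => g Gg; rewrite !inE; apply/subsetP => a; rewrite !inE.
  by move=> /andP[Ka /eqP <-]; have [-> ->] := GK g a Gg Ka; rewrite eqxx.
have := pgroup_fix_mod pG actsS.
rewrite (_ : 'Fix_(S | to)(G)%g = set0) ?cards0; last first.
  apply/setP=> a; rewrite in_set0; apply/negbTE/negP => /setIP[].
  rewrite inE => /andP[Ka _] /afixP fixa.
  by have [g Gg /eqP[]] := nofix a Ka; apply: fixa.
rewrite mod0n => /eqP; rewrite -/(dvdn p _) (dvdn_pcharf (pchar_Fp pr_p)).
by move=> /eqP->; rewrite mulr0.
Qed.

End Trace.

(** * Simplicial maps from the cone over a subdivision *)

Section Cone.
Local Open Scope ring_scope.

Lemma eq_push_supp (R : comNzRingType) (T U : finType) (K : {pred {set T}})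
    (f g : T -> U) (x : {ffun {set T} -> R^o}) :
  supp K x -> (forall s, s \in K -> {in s, f =1 g}) -> push f x = push g x.
Proof.
move=> Kx fg; move: x Kx; apply: suppP => [|c x y Hx Hy|s Ks].
- by rewrite !linear0.
- by rewrite !linearP /= Hx Hy.
- exact/eq_push/fg.
Qed.

(** Distinct simplices have distinct images under an injective map, so only [s] contributes to the
    coefficient at [a @: s]. *)
Lemma push_coef (R : comNzRingType) (T U : finType) (a : T -> U)
    (x : {ffun {set T} -> R^o}) (s : {set T}) :
  injective a -> push a x (a @: s) = x s * push a (delta R s) (a @: s) :> R.
Proof.
move=> inj_a; rewrite linear_coef (bigD1 s) //= big1 ?addr0 // => t nts.
have [c [-> _]] := push_deltaP R a t; rewrite !ffunE (inj_eq (imset_inj inj_a)).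
by rewrite eq_sym (negbTE nts) scaler0 mulr0.
Qed.

(** The obstruction in terms of one complex with an action; that some group element moves each
    nonempty simplex is what counting modulo p requires. *)
Lemma no_equivariant_map_from_cone (p k : nat) (T : finType)
    (K : {set {set T}}) (act : {action 'Z_p &-> T})
    (f : option (bd_type T k) -> T) :
  prime p -> is_complex K ->
  (forall g, simplicial_map K K (act^~ g)) ->
  (forall s, s \in K -> s != set0 -> exists g, act^~ g @: s != s) ->
  simplicial_map (cone (iterated_Bd K k)) K f ->
  ~ equivariant (iterated_Bd K k) (@bd_act p T act k) act (fun v => f (Some v)).
Proof.
move=> pr_p cK actK nofix fK eqf.
pose f' v := f (Some v); pose R : comNzRingType := 'F_p.
have cB := iterated_Bd_complex k cK.
have fcone s : s \in iterated_Bd K k -> f None |: f' @: s \in K.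
  move=> Bs; have -> : f None |: f' @: s = f @: (None |: Some @: s).
    by rewrite imsetU1 -imset_comp.
  apply: fK; apply/imset2P; exists [set None] (Some @: s) => //.
    by rewrite !inE eqxx orbT.
  exact: imset_f.
have f'A g s : s \in iterated_Bd K k ->
    {in s, f' \o (@bd_act p T act k)^~ g =1 act^~ g \o f'}.
  (* Equivariance is stated for images of simplices as sets; on singletons it becomes an equality of
     vertices. *)
  move=> Bs v vs /=; have Bv : [set v] \in iterated_Bd K k.
    by case: cB => _ down; apply: down Bs _; rewrite sub1set.
  by have := eqf g _ Bv; rewrite !imset_set1 => /set1_inj.
pose chainT := {ffun {set T} -> R^o}.
pose phi : {linear chainT -> chainT} := push f' \o iterated_sd (R := R) k.
pose h : {linear chainT -> chainT} := wedge (f None) \o phi.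
have homotopy x : bound (h x) + h (bound x) = phi x.
  by rewrite /h /phi /= bound_wedge push_bound bound_iterated_sd subrK.
have hK x : supp (mem K) x -> supp (mem K) (h x).
  move=> Kx; rewrite /h /phi /=.
  (* Support of [phi x] in [K] would not suffice, since adding [f None] to a simplex of [K] may
     leave [K]. Images of simplices of the subdivision do admit it, by [fcone]. *)
  pose im := [pred t | [exists s in iterated_Bd K k, t == f' @: s]].
  apply: (@supp_wedge _ _ im).
    apply: (supp_push (supp_iterated_sd (k := k) cK Kx)) => s Bs.
    by apply/exists_inP; exists s.
  by move=> _ /exists_inP[s Bs /eqP->]; apply: fcone.
have phi_act g s : s \in K ->
    phi (push (act^~ g) (delta R s)) = push (act^~ g) (phi (delta R s)).
  move=> Ks; rewrite /phi /= push_iterated_sd; last exact: act_inj.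
  (* [f'] commutes with the action only on vertices of the subdivision, hence the appeal to
     supports. *)
  rewrite !push_comp; apply: eq_push_supp (f'A g).
  by apply: supp_iterated_sd => //; apply: supp_delta.
pose F (s : {set T}) : R := (-1) ^+ #|s| * phi (delta R s) s.
have F_act g s : s \in K -> F (act^~ g @: s) = F s.
  move=> Ks; have inj_g := act_inj act g; rewrite /F card_imset //.
  have := congr1 (fun y : {ffun _} => y (act^~ g @: s)) (phi_act g s Ks).
  rewrite push_coef //.
  (* Moving [s] by [g] introduces the same orientation sign [c] on both sides; [c * c = 1] removes
     it. *)
  have [c [-> /(_ inj_g) c1]] := push_deltaP R (act^~ g) s.
  rewrite linearZ !ffunE eqxx => E; congr (_ * _).
  have {}E : c * phi (delta R (act^~ g @: s)) (act^~ g @: s) =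
      phi (delta R s) s * c by apply: etrans E _; congr (_ * _); apply: mulr1.
  by rewrite -[LHS]mul1r -c1 -mulrA E mulrCA c1 mulr1.
have F0 : F set0 = 1.
  by rewrite /F cards0 mul1r /phi /= iterated_sd_delta0 push_delta0 ffunE eqxx.
have := supertrace_homotopy cK hK.
under eq_bigr do rewrite homotopy.
rewrite (bigD1 set0) /=; last by case: cK.
rewrite -/(F set0) F0 (eq_bigl (mem (K :\ set0))); last first.
  by move=> s; rewrite !inE andbC.
(* The nonempty simplices contribute 0, leaving the contradiction 1 = 0 in ['F_p]. *)
rewrite (@sum_fixfree p _ [set: 'Z_p]%G _ (set_action act)) ?addr0 //.
- by rewrite /pgroup cardsT card_ord Zp_cast ?prime_gt1 // pnat_id.
- move=> g s _; rewrite !inE => /andP[s0 Ks] /=; split; last exact: F_act.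
  by rewrite -card_gt0 card_imset ?card_gt0 ?s0 ?actK //; apply: act_inj.
- move=> s; rewrite !inE => /andP[s0 Ks].
  by have [g] := nofix s Ks s0; exists g; rewrite ?inE.
Qed.

End Cone.

(** * Joins and the diagonal action *)

Section Join.
Variables (p m : nat) (T : finType) (S : 'I_m -> {set {set T}}).
Variable to : 'I_m -> {action 'Z_p &-> T}.
Hypothesis disjS :
  forall i j, i != j -> [disjoint vertices (S i) & vertices (S j)].

Lemma mem_vertices i s v : s \in S i -> v \in s -> v \in vertices (S i).
Proof. by move=> Ss vs; apply/bigcupP; exists s. Qed.

Lemma vertices_inj i j v :
  v \in vertices (S i) -> v \in vertices (S j) -> i = j.
Proof.
move=> vi vj; apply/eqP; apply: contraT => /disjS /disjointFr/(_ vi).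
by rewrite vj.
Qed.

Lemma iterated_joinP s : (forall i, set0 \in S i) ->
  s \in iterated_join S <->
  exists2 r : 'I_m -> {set T}, forall i, r i \in S i & s = \bigcup_i r i.
Proof.
move=> S0; rewrite /iterated_join; have := index_enum_uniq 'I_m.
elim: (index_enum _) s => [|i q IH] s /=.
  rewrite big_nil inE => _; split=> [/eqP->|[r _ ->]]; last by rewrite big_nil.
  by exists (fun=> set0); rewrite ?big_nil.
case/andP=> iq uq; rewrite big_cons; split.
  case/imset2P=> a b Sa /(IH _ uq)[r Sr ->] ->.
  exists (fun j => if j == i then a else r j) => [j|].
    by case: eqP => [->|].
  rewrite big_cons eqxx; congr (_ :|: _); apply: eq_big_seq => j jq.
  by case: eqP jq iq => // -> ->.
case=> r Sr ->; rewrite big_cons; apply: imset2_f => //.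
by apply/(IH _ uq); exists r.
Qed.

(** Disjointness leaves [i] as the only index that [pick] can return. *)
Lemma diagonal_actE i v g :
  v \in vertices (S i) -> diagonal_act S to v g = to i v g.
Proof.
move=> vi; rewrite /diagonal_act; case: pickP => [j vj|/(_ i)].
  by rewrite (vertices_inj vi vj).
by rewrite vi.
Qed.

Hypothesis freeS : forall i, free_simplicial_action (S i) (to i).

Lemma vertices_act i v g :
  v \in vertices (S i) -> to i v g \in vertices (S i).
Proof.
case/bigcupP=> s Ss vs; apply: (@mem_vertices i ((to i)^~ g @: s)).
  by have [actS _] := freeS i; apply: actS.
exact: imset_f.
Qed.

Lemma diagonal_act1 : (diagonal_act S to)^~ 1%g =1 id.
Proof.
by move=> v; rewrite /diagonal_act; case: pickP => // i _; apply: act1.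
Qed.

(** Acting keeps a vertex of [S i] among the vertices of [S i], so successive applications use the
    same index; all other points are fixed. *)
Lemma diagonal_actM v : act_morph (diagonal_act S to) v.
Proof.
move=> g h; have [/existsP[i vi]|/existsPn nv] :=
  boolP [exists i, v \in vertices (S i)].
  by rewrite !(diagonal_actE _ vi) (diagonal_actE _ (vertices_act g vi)) actM.
have fix_v g' : diagonal_act S to v g' = v.
  by rewrite /diagonal_act; case: pickP => // i; rewrite (negbTE (nv i)).
by rewrite !fix_v.
Qed.

Definition diagonal_action : {action 'Z_p &-> T} :=
  TotalAction diagonal_act1 diagonal_actM.

Hypothesis complexS : forall i, is_complex (S i).

Let S0 i : set0 \in S i. Proof. by have [] := complexS i. Qed.

Lemma imset_diagonal_act i s g :
  s \in S i -> diagonal_act S to ^~ g @: s = (to i)^~ g @: s.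
Proof.
by move=> Ss; apply: eq_in_imset => v /(mem_vertices Ss) /diagonal_actE.
Qed.

Lemma iterated_join_complex : is_complex (iterated_join S).
Proof.
split=> [|s t].
  by apply/iterated_joinP => //; exists (fun=> set0); rewrite ?big1.
move=> /iterated_joinP[]// r Sr -> tr; apply/iterated_joinP => //.
exists (fun i => t :&: r i) => [i|].
  by have [_ down] := complexS i; apply: down (Sr i) (subsetIr _ _).
by rewrite -big_distrr /=; apply/esym/setIidPl.
Qed.

Lemma diagonal_act_simplicial g :
  simplicial_map (iterated_join S) (iterated_join S) (diagonal_action^~ g).
Proof.
move=> s /iterated_joinP[]// r Sr ->; apply/iterated_joinP => //.
exists (fun i => (to i)^~ g @: r i) => [i|].
  by have [+ _] := freeS i; apply.
rewrite (big_morph _ (imsetU _) (imset0 _)); apply: eq_bigr => i _.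
exact: imset_diagonal_act.
Qed.

(** If [g] fixed [s], it would send a nonempty component [r i] into [s] while keeping its vertices
    in [S i]; by disjointness it would map [r i] to itself, against freeness on [S i]. *)
Lemma diagonal_act_free g s : g != 1%g -> s \in iterated_join S -> s != set0 ->
  diagonal_action^~ g @: s != s.
Proof.
move=> g1 /iterated_joinP[]// r Sr Es s0; apply/eqP => fix_s.
have [i ri0] : exists i, r i != set0.
  apply/existsP; apply: contraNT s0 => /existsPn r0.
  by rewrite Es big1 // => i _; apply/eqP/negbNE/r0.
have [_ /(_ g (r i))] := freeS i; apply=> //; [exact/eqP | exact/eqP |].
apply/eqP; rewrite eqEcard card_imset ?leqnn ?andbT; last exact: act_inj.
rewrite -imset_diagonal_act //; apply/subsetP=> _ /imsetP[v vr ->].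
have vi := mem_vertices (Sr i) vr.
have : diagonal_act S to v g \in s.
  rewrite -fix_s; apply/imsetP; exists v => //.
  by rewrite Es; apply/bigcupP; exists i.
rewrite Es => /bigcupP[j _ vj].
suff -> : i = j by [].
apply: vertices_inj (mem_vertices (Sr j) vj).
by rewrite (diagonal_actE _ vi); apply: vertices_act.
Qed.

End Join.

Theorem theorem1p8 (p k m : nat) (T : finType) (S : 'I_m -> {set {set T}})
    (to : 'I_m -> {action 'Z_p &-> T}) :
  prime p -> 1 <= m ->
  (forall i, Zp_combinatorial_sphere (S i) (to i)) ->
  (forall i j, i != j -> [disjoint vertices (S i) & vertices (S j)]) ->
  ~ exists f : option (bd_type T k) -> T,
      simplicial_map (cone (iterated_Bd (iterated_join S) k))
                     (iterated_join S) f /\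
      equivariant (iterated_Bd (iterated_join S) k)
                  (@bd_act p T (diagonal_act S to) k) (diagonal_act S to)
                  (fun v => f (Some v)).
Proof.
move=> pr_p _ sphereS disjS [f [fK eqf]].
have freeS i : free_simplicial_action (S i) (to i) by have [] := sphereS i.
have complexS i : is_complex (S i) by have [[d [[]]]] := sphereS i.
apply: (@no_equivariant_map_from_cone p k T (iterated_join S)
  (diagonal_action disjS freeS) f) => //.
- exact: iterated_join_complex.
- exact: diagonal_act_simplicial.
(* The identity [1%g] is the residue 0, so [Zp1] is a non-identity element and freeness applies to
   it. *)
- by move=> s Ks s0; exists (Zp1 : 'Z_p); apply: diagonal_act_free.
Qed.
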